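(* Let $\epsilon\in[0,\sqrt2]$ and let $\delta\in(0,\bar\delta)$, where $\bar\delta$ is the constant defined in the context. Then there exists $C>0$ such that for all $f^0,g^0\in\ell_\infty(\mathbb{Z})$ that are both strictly increasing or both strictly decreasing and satisfy $\rho(\nabla f^0)<\delta$ and $\rho(\nabla g^0)<\delta$, $$\|S_\epsilon^\infty f^0-S_\epsilon^\infty g^0\|_\infty\le C\,\|f^0-g^0\|_\infty .$$
   Context: $\ell_\infty(\mathbb{Z})$ is the space of bounded real sequences with the sup norm; $\nabla f=(f_{i+1}-f_i)_{i\in\mathbb{Z}}$; $\|\cdot\|_\infty$ on functions is the sup norm on $\mathbb{R}$. On strictly monotone sequences, for any $\epsilon\in[0,\sqrt2]$, the interpolatory scheme $S_\epsilon$ is given (independently of $\epsilon$) by $$(S_\epsilon f)_{2i}=f_i,\quad (S_\epsilon f)_{2i+1}=\tfrac12 f_i+\tfrac12 f_{i+1}-\frac12\,\frac{f_{i+2}-f_{i+1}-f_i+f_{i-1}}{\left(1+\sqrt{1+\frac{f_{i+2}-f_{i-1}}{f_{i+1}-f_i}}\right)^2-1},$$ and it maps strictly increasing (decreasing) sequences to strictly increasing (decreasing) ones. $S_\epsilon^\infty f^0$ is the continuous function with $\lim_{k\to\infty}\sup_i|f^k_i-(S_\epsilon^\infty f^0)(i2^{-k})|=0$, where $f^{k+1}=S_\epsilon f^k$ (it exists for strictly monotone $f^0\in\ell_\infty(\mathbb{Z})$). For a sequence $d$ with all entries positive or all negative, $$\rho(d)=\sup_{i\in\mathbb{Z}}\max\left\{\left|\frac{d_i}{d_{i+1}}-1\right|,\left|\frac{d_{i+1}}{d_i}-1\right|\right\}\in[0,+\infty].$$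 On such sequences define $$(S_\epsilon^{(1)}d)_{2i+j}=d_i\left(1+(-1)^jH\!\left(\frac{d_{i-1}}{d_i},\frac{d_{i+1}}{d_i}\right)\right),\quad j=0,1,\qquad H(x,y)=\frac{x-y}{2+x+y+2\sqrt{2+x+y}}.$$ For each $\eta\in(\frac34,1)$ let $\delta_\eta>0$ be a number such that for every $d^0\in\ell_\infty(\mathbb{Z})$ with all entries positive or all negative and $\rho(d^0)<\delta_\eta$, the sequences $d^k=S^{(1)}_\epsilon d^{k-1}$ $(k\ge1)$ satisfy $\rho(d^{k+2})\le\eta\,\rho(d^k)$ for all $k\ge0$ (such numbers exist). Then $\bar\delta:=\sup_{3/4<\eta<1}\delta_\eta$. *)

(* Defs.v *)
From HB Require Import structures.
From mathcomp Require Import all_boot all_order all_algebra.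
From mathcomp Require Import all_classical all_reals all_analysis.
Set Implicit Arguments.
Unset Strict Implicit.
Unset Printing Implicit Defensive.
Import Order.TTheory GRing.Theory Num.Theory.
Import numFieldNormedType.Exports.
Local Open Scope classical_set_scope.
Local Open Scope ring_scope.

Section SubdivisionScheme.
Context {R : realType}.
Implicit Types (eps : R) (f d : int -> R) (F : R -> R).

(* Extended-real valued, so that unbounded functions have norm +oo. *)
Definition sup_norm {I : Type} (h : I -> R) : \bar R :=
  ereal_sup (range (fun i => `|h i|%:E)).

Definition strictly_increasing f := {homo f : i j / i < j}.
Definition strictly_decreasing f := {homo f : i j /~ i < j}.

Definition nabla f : int -> R := fun i => f (i + 1) - f i.

(* The sequence whose entry of index 2i + j is a j i, for j = 0 (false) and
   j = 1 (true); see weaveE. *)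
Definition weave (a : bool -> int -> R) : int -> R :=
  fun n => a ((n %% 2)%Z != 0) (n %/ 2)%Z.

Lemma weaveE (a : bool -> int -> R) (i : int) (j : bool) :
  weave a (2 * i + (j : nat)%:Z) = a j i.
Proof.
rewrite /weave mulrC divzMDl // modzMDl.
by case: j => /=; rewrite addr0.
Qed.

(* The formula is the one valid on strictly monotone sequences, the only ones
   on which the scheme is used; there it does not involve eps. *)
Definition scheme eps f : int -> R :=
  weave (fun j i =>
    if j then
      2^-1 * f i + 2^-1 * f (i + 1)
      - 2^-1 * ((f (i + 2) - f (i + 1) - f i + f (i - 1)) /
          ((1 + Num.sqrt (1 + (f (i + 2) - f (i - 1)) / (f (i + 1) - f i))) ^+ 2
           - 1))
    else f i).

Definition is_limit_function eps f F : Prop :=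
  continuous F /\
  sup_norm (fun i : int => iter k (scheme eps) f i - F (i%:~R * 2 ^- k))
    @[k --> \oo] --> 0%E.

(* A continuous function is determined by its limits along dyadic points, so
   at most one F is a limit function; the default value 0 is irrelevant when
   one exists, as it does for bounded strictly monotone f. *)
Definition limit_function eps f : R -> R :=
  xget (fun=> 0) [set F | is_limit_function eps f F].

Definition one_signed d : Prop :=
  (forall i, 0 < d i) \/ (forall i, d i < 0).

Definition rho d : \bar R :=
  ereal_sup (range (fun i : int =>
    (Num.max `|d i / d (i + 1) - 1| `|d (i + 1) / d i - 1|)%:E)).

Definition H (x y : R) : R :=
  (x - y) / (2 + x + y + 2 * Num.sqrt (2 + x + y)).

(* When f is strictly monotone, nabla (scheme eps f) is one half of
   scheme1 eps (nabla f). *)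
Definition scheme1 eps d : int -> R :=
  weave (fun j i =>
    d i * (1 + (-1) ^+ j * H (d (i - 1) / d i) (d (i + 1) / d i))).

Definition rho_contractive eps (eta delta_eta : R) : Prop :=
  forall d, bounded_fun d -> one_signed d -> (rho d < delta_eta%:E)%E ->
  forall k : nat,
    (rho (iter k.+2 (scheme1 eps) d) <= eta%:E * rho (iter k (scheme1 eps) d))%E.

Definition admissible_thresholds eps (delta_ : R -> R) : Prop :=
  forall eta, 3 / 4 < eta < 1 ->
    0 < delta_ eta /\ rho_contractive eps eta (delta_ eta).

(* The supremum may be +oo. *)
Definition delta_bar (delta_ : R -> R) : \bar R :=
  ereal_sup [set (delta_ eta)%:E | eta in [set eta | 3 / 4 < eta < 1]].

End SubdivisionScheme.

(* Main.v *)
Require Import Defs.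
From HB Require Import structures.
From mathcomp Require Import all_boot all_order all_algebra.
From mathcomp Require Import all_classical all_reals all_analysis.
From mathcomp Require Import ring lra.
Set Implicit Arguments.
Unset Strict Implicit.
Unset Printing Implicit Defensive.
Import Order.TTheory GRing.Theory Num.Theory.
Import numFieldNormedType.Exports.
Local Open Scope classical_set_scope.
Local Open Scope ring_scope.

(** With d = nabla f, the odd values are the midpoints of f corrected by
    (1/2) (a - c) h(2 + (a + c) / b), where (a, b, c) = (d_(i-1), d_i, d_(i+1))
    and h(s) = 1 / (s + 2 sqrt s). For nearly constant d the argument of h is
    near 4, h(4) = 1/8, and the scheme is close to the linear four-point scheme,
    whose increments contract by 1/2 + 1/8 < 1. Quantitatively, if rho <= r for
    both sequences, the corrections differ by at most 1/8 + r (6 + 2 r) times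
    p = |nabla f - nabla g|_oo. Since rho decays geometrically, after m steps,
    m depending only on delta and eta, r <= 1/64 and |f - g|_oo + p no longer
    grows; each earlier step multiplies it by a bounded factor. *)

(** * The nonlinear correction at odd points and its dependence on the increments *)

Section Correction.
Context {R : realType}.
Implicit Types (a b c r s t x y : R).

(** Reciprocal of the denominator [(1 + sqrt s)^2 - 1] of the scheme, expanded. *)
Definition damping s : R := (s + 2 * Num.sqrt s)^-1.

Lemma damping_gt0 s : 2 <= s -> 0 < damping s.
Proof.
move=> s2; rewrite invr_gt0; have := sqrtr_ge0 s; lra.
Qed.

Lemma damping_4 : damping 4 = 8^-1.
Proof.
rewrite /damping (_ : Num.sqrt 4 = 2); first by congr (_^-1); ring.
by rewrite -(_ : 2 ^+ 2 = 4 :> R) ?sqrtr_sqr ?ger0_norm //; ring.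
Qed.

Lemma sqrt_ge1 s : 1 <= s -> 1 <= Num.sqrt s.
Proof. by move=> s1; rewrite -{1}sqrtr1 ler_sqrt // (le_trans _ s1). Qed.

Lemma sqrt_lipschitz s t : 1 <= s -> 1 <= t ->
  `|Num.sqrt s - Num.sqrt t| <= `|s - t|.
Proof.
move=> s1 t1; have ps := sqrt_ge1 s1; have pt := sqrt_ge1 t1.
have -> : s - t = (Num.sqrt s - Num.sqrt t) * (Num.sqrt s + Num.sqrt t).
  by rewrite -subr_sqr !sqr_sqrtr; lra.
rewrite normrM ler_peMr // ger0_norm; lra.
Qed.

(** On [[2, +oo)] the map [s + 2 sqrt s] is 3-Lipschitz, and passing to reciprocals multiplies by
    two values of [damping], each at most 1/2. *)
Lemma damping_lipschitz s t : 2 <= s -> 2 <= t ->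
  `|damping s - damping t| <= 3 / 4 * `|s - t|.
Proof.
move=> s2 t2.
have ps := sqrtr_ge0 s; have pt := sqrtr_ge0 t.
have ds : s + 2 * Num.sqrt s != 0 by lra.
have dt : t + 2 * Num.sqrt t != 0 by lra.
have -> : damping s - damping t =
    (t - s + 2 * (Num.sqrt t - Num.sqrt s)) * (damping s * damping t).
  by rewrite /damping; field; rewrite ds dt.
have half (u : R) : 2 <= u -> damping u <= 2^-1.
  move=> u2; rewrite /damping lef_pV2 ?posrE; have := sqrtr_ge0 u; lra.
have hs := half _ s2; have ht := half _ t2.
have gs := damping_gt0 s2; have gt := damping_gt0 t2.
rewrite normrM (ger0_norm (mulr_ge0 (ltW gs) (ltW gt))).
have -> : 3 / 4 * `|s - t| = (3 * `|s - t|) * (2^-1 * 2^-1) by field.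
apply: ler_pM => //; [by rewrite mulr_ge0 // ltW| |by apply: ler_pM => //; exact: ltW].
apply: (le_trans (ler_normD _ _)); rewrite normrM distrC ger0_norm //.
rewrite (distrC (Num.sqrt t)).
have := @sqrt_lipschitz s t; lra.
Qed.

Definition correction a b c : R := 2^-1 * ((a - c) * damping (2 + (a + c) / b)).

(** The schemes on values and on increments share one nonlinearity: the correction is half of the
    perturbation of [d i] in [scheme1]. *)
Lemma correctionE a b c : b != 0 ->
  correction a b c = 2^-1 * (b * H (a / b) (c / b)).
Proof.
move=> b0; rewrite /correction /H /damping; congr (_ * _).
have -> : 2 + (a + c) / b = 2 + a / b + c / b by rewrite mulrDl addrA.
by rewrite [RHS]mulrA -mulrBl mulrCA mulfV // mulr1.
Qed.

(** Drop the square root and use [|x - y| <= x + y]: what remains, [(x + y) / (2 + x + y)],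
    increases with [x + y <= 2 + 2 r]. *)
Lemma H_bound x y r : 0 < x -> 0 < y -> x <= 1 + r -> y <= 1 + r ->
  `|H x y| <= 1 - (2 + r)^-1.
Proof.
move=> x0 y0 xr yr; rewrite /H normrM normfV.
have q0 : 0 < (2 + r)^-1 by rewrite invr_gt0; lra.
have qr : (2 + r)^-1 * (2 + r) = 1 by rewrite mulVf //; lra.
have q1 : (2 + r)^-1 <= 1 by rewrite invf_le1; lra.
have sq := sqrtr_ge0 (2 + x + y).
set q := (2 + r)^-1 in q0 qr q1 *; set u := Num.sqrt _ in sq *.
rewrite (@ger0_norm _ (2 + _ + _ + _)); last by lra.
rewrite ler_pdivrMr; last by lra.
apply: (@le_trans _ _ (x + y)); first by rewrite ler_norml; lra.
have : q * (x + y) <= 2 * q * (1 + r) by rewrite (mulrC 2) -mulrA ler_pM2l; lra.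
have : 0 <= (1 - q) * (2 * u) by rewrite mulr_ge0 //; lra.
lra.
Qed.

(** [8^-1] is [damping 4], the value for equal increments; the rest rounds up the error
    [9/2 r + 3/2 r^2] obtained in [correction_dist]. *)
Definition correction_constant r : R := 8^-1 + r * (6 + 2 * r).

Lemma correction_constant_ge0 r : 0 <= r -> 0 <= correction_constant r.
Proof. by move=> r0; rewrite addr_ge0 // mulr_ge0 // addr_ge0 // mulr_ge0. Qed.

(** The increments may be arbitrarily small, so no division by [b] or [b'] can survive in the bound;
    homogeneity of the correction provides the cancellation. *)
Lemma correction_dist a b c a' b' c' r p :
  0 < a -> 0 < b -> 0 < c -> 0 < a' -> 0 < b' -> 0 < c' ->
  `|a / b - 1| <= r -> `|c / b - 1| <= r ->
  `|a' / b' - 1| <= r -> `|c' / b' - 1| <= r ->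
  `|a - a'| <= p -> `|b - b'| <= p -> `|c - c'| <= p ->
  `|correction a b c - correction a' b' c'| <= correction_constant r * p.
Proof.
move=> a0 b0 c0 a'0 b'0 c'0 hx hy hx' hy' da db dc.
have pos (u v : R) : 0 < u -> 0 < v -> 0 < u / v by move=> *; rewrite divr_gt0.
have x0 := pos _ _ a0 b0; have y0 := pos _ _ c0 b0.
have x'0 := pos _ _ a'0 b'0; have y'0 := pos _ _ c'0 b'0.
have p0 : 0 <= p by apply: le_trans da.
have r0 : 0 <= r by apply: le_trans hx.
rewrite /correction /correction_constant !(mulrDl _ _ b^-1) !(mulrDl _ _ b'^-1).
set s := 2 + _; set s' := 2 + _.
have s2 : 2 <= s by rewrite /s; lra.
have s'2 : 2 <= s' by rewrite /s'; lra.
(* First [a - c] varies with the damping fixed, then the damping varies. *)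
have -> : 2^-1 * ((a - c) * damping s) - 2^-1 * ((a' - c') * damping s') =
  2^-1 * (((a - a') - (c - c')) * damping s
   + (a' - c') * (damping s - damping s')) by ring.
(* [s] lies within [2 r] of 4. *)
have h1 : damping s <= 8^-1 + 3 / 2 * r.
  have := @damping_lipschitz s 4 s2; rewrite damping_4.
  have : `|s - 4| <= 2 * r by move: hx hy; rewrite !ler_norml /s; lra.
  have := ler_norm (damping s - 8^-1); lra.
(* [a' - c'] is [b'] times a factor of size at most [2 r]; this [b'] then clears the denominator
   [b'] in [s - s'], leaving only differences of increments and ratios close to 1. *)
have h2 : `|(a' - c') * (damping s - damping s')| <= 3 * r * (2 + r) * p.
  have -> : a' - c' = (a' / b' - c' / b') * b' by field; lra.
  rewrite -mulrA normrM.
  have k1 : `|a' / b' - c' / b'| <= 2 * r by move: hx' hy'; rewrite !ler_norml; lra.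
  have k2 : `|b' * (damping s - damping s')| <= 3 / 4 * (2 * (2 + r) * p).
    rewrite normrM gtr0_norm //.
    apply: (@le_trans _ _ (b' * (3 / 4 * `|s - s'|))).
      by rewrite ler_pM2l //; apply: damping_lipschitz.
    rewrite mulrCA -{1}(gtr0_norm b'0) -normrM.
    have -> : b' * (s - s') =
        (a - a') + (c - c') - (a / b + c / b) * (b - b').
      by rewrite /s /s'; field; lra.
    rewrite ler_pM2l //.
    have k3 : `|(a / b + c / b) * (b - b')| <= 2 * (1 + r) * p.
      rewrite normrM ler_pM // ger0_norm; last lra.
      by move: hx hy; rewrite !ler_norml; lra.
    move: da dc k3; rewrite !ler_norml; lra.
  apply: (le_trans (ler_pM (normr_ge0 _) (normr_ge0 _) k1 k2)).
  by rewrite le_eqVlt; apply/orP; left; apply/eqP; field.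
have h3 : `|((a - a') - (c - c')) * damping s| <= 2 * p * (8^-1 + 3 / 2 * r).
  rewrite normrM (gtr0_norm (damping_gt0 s2)) ler_pM ?(ltW (damping_gt0 s2)) //.
  by move: da dc; rewrite !ler_norml; lra.
rewrite normrM gtr0_norm ?invr_gt0 //.
have := ler_normD (((a - a') - (c - c')) * damping s)
  ((a' - c') * (damping s - damping s')).
have rp : 0 <= r * p by rewrite mulr_ge0.
have rrp : 0 <= r * (r * p) by rewrite mulr_ge0.
move: h2 h3; lra.
Qed.

End Correction.

(** * The two schemes by parity, and the passage from values to increments *)

Lemma even_odd_ind (P : int -> Prop) :
  (forall i, P (2 * i)) -> (forall i, P (2 * i + 1)) -> forall n, P n.
Proof.
move=> P0 P1 n; rewrite (divz_eq n 2) mulrC.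
have := modz_ge0 n (isT : 2 != 0 :> int).
have := ltz_pmod n (isT : 0 < 2 :> int).
case: (modz n 2) => // -[|[|//]] _ _; [rewrite addr0; exact: P0|exact: P1].
Qed.

Section Scheme.
Context {R : realType}.
Implicit Types (eps r c p U : R) (f g d e : int -> R).

Definition positive_seq d := forall i, 0 < d i.

(** Real-valued form of a bound on [rho], which itself may be [+oo]. *)
Definition ratios_le r d :=
  forall i, `|d i / d (i + 1) - 1| <= r /\ `|d (i + 1) / d i - 1| <= r.

Lemma rho_leP d r : (rho d <= r%:E)%E <-> ratios_le r d.
Proof.
split=> [dr i|dr].
  have : ((Num.max `|d i / d (i + 1) - 1| `|d (i + 1) / d i - 1|)%:E <= rho d)%E.
    by apply: ereal_sup_ubound; exists i.
  move=> /le_trans /(_ dr).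
  by rewrite lee_fin ge_max => /andP.
apply: ge_ereal_sup => _ [i _ <-]; rewrite lee_fin ge_max.
by have [-> ->] := dr i.
Qed.

Lemma ratios_le_trans r s d : r <= s -> ratios_le r d -> ratios_le s d.
Proof. by move=> rs dr i; have [h1 h2] := dr i; split; exact: le_trans rs. Qed.

(** Only quotients enter [rho]. This absorbs the factors 1/2 of each level, and the sign in the
    decreasing case. *)
Lemma rho_scale c d : c != 0 -> rho (fun i => c * d i) = rho d.
Proof.
move=> c0; rewrite /rho; congr ereal_sup; apply: eq_imagel => i _.
by rewrite -!(mulf_div c) divff // !mul1r.
Qed.

Lemma weave_even (a : bool -> int -> R) i : weave a (2 * i) = a false i.
Proof. by have := weaveE a i false; rewrite addr0. Qed.

Lemma weave_odd (a : bool -> int -> R) i : weave a (2 * i + 1) = a true i.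
Proof. exact: (weaveE a i true). Qed.

Lemma scheme_even eps f i : scheme eps f (2 * i) = f i.
Proof. exact: weave_even. Qed.

Lemma scheme1_even eps d i :
  scheme1 eps d (2 * i) = d i * (1 + H (d (i - 1) / d i) (d (i + 1) / d i)).
Proof. by rewrite /scheme1 weave_even mul1r. Qed.

Lemma scheme1_odd eps d i :
  scheme1 eps d (2 * i + 1) = d i * (1 - H (d (i - 1) / d i) (d (i + 1) / d i)).
Proof. by rewrite /scheme1 weave_odd mulN1r. Qed.

Lemma scheme1_scale eps c d : c != 0 ->
  scheme1 eps (fun i => c * d i) = (fun i => c * scheme1 eps d i).
Proof.
by move=> c0; apply/funext; apply: even_odd_ind => i;
  rewrite ?scheme1_even ?scheme1_odd -!(mulf_div c) divff // !mul1r mulrA.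
Qed.

Lemma H_lt1 (x y : R) : 0 < x -> 0 < y -> `|H x y| < 1.
Proof.
move=> x0 y0.
(* With [r = x + y] both upper bounds in [H_bound] are immediate. *)
apply: (le_lt_trans (@H_bound _ x y (x + y) x0 y0 _ _)); [lra..|].
by rewrite gtrBl invr_gt0; lra.
Qed.

Lemma scheme1_positive eps d : positive_seq d -> positive_seq (scheme1 eps d).
Proof.
move=> d0; apply: even_odd_ind => i; rewrite ?scheme1_even ?scheme1_odd;
  apply: mulr_gt0 => //;
  have := H_lt1 (divr_gt0 (d0 (i - 1)) (d0 i)) (divr_gt0 (d0 (i + 1)) (d0 i));
  rewrite ltr_norml; lra.
Qed.

Lemma increasing_nabla f : strictly_increasing f -> positive_seq (nabla f).
Proof. by move=> fi i; rewrite subr_gt0; apply: fi; rewrite ltrDl. Qed.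

Lemma scheme_odd eps f i : positive_seq (nabla f) ->
  scheme eps f (2 * i + 1) = 2^-1 * f i + 2^-1 * f (i + 1)
    + correction (nabla f (i - 1)) (nabla f i) (nabla f (i + 1)).
Proof.
move=> f0; rewrite /scheme weave_odd.
have := f0 (i - 1); have := f0 i; have := f0 (i + 1).
rewrite /nabla subrK -addrA.
set a := f _; set b := f (i + _); set x := f i; set y := f (i - 1) => p1 p2 p3.
rewrite /correction /damping.
(* The increment over three cells is the sum of three increments; dividing by the middle one
   contributes a further 1. *)
have -> : 1 + (a - y) / (b - x) = 2 + (x - y + (a - b)) / (b - x) by field; lra.
set s := 2 + _.
have s2 : 2 <= s by rewrite /s lerDl divr_ge0; lra.
rewrite (_ : (1 + Num.sqrt s) ^+ 2 - 1 = s + 2 * Num.sqrt s); last first.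
  rewrite -{2}(@sqr_sqrtr _ s); [ring|lra].
ring.
Qed.

(** The inserted point cuts each increment into its half plus the correction and its half minus the
    correction. *)
Lemma nabla_scheme eps f : positive_seq (nabla f) ->
  nabla (scheme eps f) = (fun i => 2^-1 * scheme1 eps (nabla f) i).
Proof.
move=> f0; apply/funext; apply: even_odd_ind => i;
  rewrite {1}/nabla ?scheme1_even ?scheme1_odd.
  rewrite scheme_odd // scheme_even correctionE ?gt_eqF //.
  set h := H _ _; have : f (i + 1) = f i + nabla f i by rewrite /nabla; ring.
  move: (nabla f i) => d ->; lra.
rewrite scheme_odd // correctionE ?gt_eqF //.
rewrite (_ : 2 * i + 1 + 1 = 2 * (i + 1)) ?scheme_even; last by ring.
set h := H _ _; have : f (i + 1) = f i + nabla f i by rewrite /nabla; ring.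
move: (nabla f i) => d ->; lra.
Qed.

End Scheme.

(** * Decay of the ratios and of the increments, and growth of the distance under iteration *)

Section Iterates.
Context {R : realType}.
Implicit Types (eps r c p U W D eta : R) (f g d e : int -> R).

Lemma bounded_funE {T : Type} (h : T -> R) :
  bounded_fun h <-> exists M, forall t, `|h t| <= M.
Proof.
split=> [[M [_ hM]]|[M hM]].
  (* [bounded_fun] guarantees only the bounds strictly above [M]. *)
  by exists (M + 1) => t; apply: hM => //; rewrite ltrDl.
by exists M; split=> [|M' MM' t _]; [exact: num_real|exact: le_trans (ltW MM')].
Qed.

Lemma bounded_nabla f : bounded_fun f -> bounded_fun (nabla f).
Proof.
move=> /bounded_funE[M fM]; apply/bounded_funE; exists (M + M) => i.
by apply: (le_trans (ler_normB _ _)); apply: lerD.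
Qed.

(** By [H_bound], [1 + H] and [1 - H] both stay at distance at least [(2 + r)^-1] from 0 and from
    2. *)
Lemma scheme1_even_bounds eps r d i : positive_seq d -> ratios_le r d ->
  (2 + r)^-1 * d i <= scheme1 eps d (2 * i) <= (2 - (2 + r)^-1) * d i.
Proof.
move=> d0 dr; rewrite scheme1_even (mulrC (d i)) !ler_pM2r //.
have [_ h1] := dr i; have [h2 _] := dr (i - 1); rewrite subrK in h2.
have := @H_bound _ _ _ r (divr_gt0 (d0 (i - 1)) (d0 i)) (divr_gt0 (d0 (i + 1)) (d0 i)).
move: h1 h2; rewrite !ler_norml => h1 h2 h3.
by have {h3} := h3 ltac:(lra) ltac:(lra); lra.
Qed.

Lemma scheme1_odd_bounds eps r d i : positive_seq d -> ratios_le r d ->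
  (2 + r)^-1 * d i <= scheme1 eps d (2 * i + 1) <= (2 - (2 + r)^-1) * d i.
Proof.
move=> d0 dr; rewrite scheme1_odd (mulrC (d i)) !ler_pM2r //.
have [_ h1] := dr i; have [h2 _] := dr (i - 1); rewrite subrK in h2.
have := @H_bound _ _ _ r (divr_gt0 (d0 (i - 1)) (d0 i)) (divr_gt0 (d0 (i + 1)) (d0 i)).
move: h1 h2; rewrite !ler_norml => h1 h2 h3.
by have {h3} := h3 ltac:(lra) ltac:(lra); lra.
Qed.

(** A crude one-step bound: the contraction hypothesis compares levels two apart, so level 1 must be
    bounded separately. New neighbours come from equal or adjacent old increments, whose ratio is at
    most [1 + r]; one is at most twice its parent, the other at least its parent over [2 + r]. *)
Lemma ratios_scheme1 eps r d : 0 <= r -> positive_seq d -> ratios_le r d ->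
  ratios_le (2 * (2 + r) * (1 + r)) (scheme1 eps d).
Proof.
move=> r0 d0 dr; set M := 2 * _ * _.
have q0 : 0 < (2 + r)^-1 by rewrite invr_gt0; lra.
have M1 : 1 <= M by rewrite /M; nra.
have e0 := scheme1_positive eps d0.
(* Since [M >= 1] and [u / v > 0], an upper bound on [u / v] suffices. *)
have near1 (u v : R) : 0 < u -> 0 < v -> u <= M * v -> `|u / v - 1| <= M.
  move=> u0 v0; rewrite -ler_pdivrMr // => uv.
  by have := divr_gt0 u0 v0; rewrite ler_norml; lra.
have cmp i j (u v : R) : d i <= (1 + r) * d j ->
    u <= (2 - (2 + r)^-1) * d i -> (2 + r)^-1 * d j <= v -> u <= M * v.
  move=> dij ui vj.
  have h1 : u <= 2 * d i by have := mulr_gt0 q0 (d0 i); lra.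
  have h2 : d j <= (2 + r) * v by move: vj; rewrite ler_pdivrMl //; lra.
  have : (1 + r) * d j <= (1 + r) * ((2 + r) * v) by rewrite ler_pM2l //; lra.
  by rewrite /M; lra.
have dS i : d i <= (1 + r) * d (i + 1) /\ d (i + 1) <= (1 + r) * d i.
  have [] := dr i; rewrite !ler_norml -!ler_pdivrMr //; lra.
have dI i : d i <= (1 + r) * d i by have := d0 i; nra.
have ev i := @scheme1_even_bounds eps r d i d0 dr.
have od i := @scheme1_odd_bounds eps r d i d0 dr.
apply: even_odd_ind => i.
  have /andP[? ?] := ev i; have /andP[? ?] := od i.
  by split; apply: near1 => //; apply: (cmp i i).
rewrite (_ : 2 * i + 1 + 1 = 2 * (i + 1)); last by ring.
have /andP[? ?] := ev (i + 1); have /andP[? ?] := od i; have [? ?] := dS i.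
by split; apply: near1 => //; [apply: (cmp i (i + 1))|apply: (cmp (i + 1) i)].
Qed.

Lemma nabla_iter eps f k : positive_seq (nabla f) ->
  positive_seq (nabla (iter k (scheme eps) f)) /\
  nabla (iter k (scheme eps) f) =
    (fun i => 2^-1 ^+ k * iter k (scheme1 eps) (nabla f) i).
Proof.
move=> f0; elim: k => [|k [pk ek]] /=.
  by split=> //; apply/funext => i; rewrite mul1r.
rewrite nabla_scheme //; split.
  by move=> i; rewrite mulr_gt0 ?invr_gt0 //; exact: scheme1_positive.
rewrite ek scheme1_scale ?expf_neq0 ?invr_eq0 //.
by apply/funext => i; rewrite exprS mulrA.
Qed.

Lemma rho_nabla_iter eps f k : positive_seq (nabla f) ->
  rho (nabla (iter k (scheme eps) f)) = rho (iter k (scheme1 eps) (nabla f)).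
Proof.
by move=> f0; rewrite (nabla_iter eps k f0).2 rho_scale // expf_neq0 // invr_eq0.
Qed.

(** The contraction acts every second level, hence the exponent [k./2] and an induction carrying two
    consecutive levels. *)
Lemma rho_decay eps eta delta_eta r d : 0 <= r -> 0 <= eta ->
  rho_contractive eps eta delta_eta ->
  bounded_fun d -> positive_seq d -> (rho d < delta_eta%:E)%E ->
  (rho d <= r%:E)%E -> forall k : nat,
  (rho (iter k (scheme1 eps) d) <= (eta ^+ k./2 * (2 * (2 + r) * (1 + r)))%:E)%E.
Proof.
move=> r0 eta0 contr bd d0 lt_rho le_rho k; set M := 2 * _ * _.
suff : (rho (iter k (scheme1 eps) d) <= (eta ^+ k./2 * M)%:E)%E /\
       (rho (iter k.+1 (scheme1 eps) d) <= (eta ^+ k.+1./2 * M)%:E)%E by case.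
elim: k => [|k [IH0 IH1]].
  split; rewrite /= mul1r; last exact/rho_leP/ratios_scheme1/rho_leP.
  by apply: (le_trans le_rho); rewrite lee_fin /M; nra.
split=> //; apply: (le_trans (contr d bd (or_introl d0) lt_rho k)).
by rewrite /= exprS -mulrA EFinM; apply: lee_wpmul2l; rewrite ?lee_fin.
Qed.

(** A child increment is at most [(2 - (2 + r)^-1) / 2] times its parent. The factor is below 1 for
    fixed [r], which makes the increments decay geometrically. *)
Lemma nabla_scheme_le eps r D f : positive_seq (nabla f) ->
  ratios_le r (nabla f) -> 0 <= r -> (forall i, nabla f i <= D) ->
  forall i, nabla (scheme eps f) i <= (1 - (2 * (2 + r))^-1) * D.
Proof.
move=> f0 fr r0 fD; rewrite nabla_scheme // invfM.
have q1 : (2 + r)^-1 <= 1 by rewrite invf_le1; lra.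
have key i : (2 - (2 + r)^-1) * nabla f i <= (2 - (2 + r)^-1) * D.
  by rewrite ler_pM2l //; lra.
by apply: even_odd_ind => i; have := key i;
  [have := @scheme1_even_bounds eps r _ i f0 fr
  |have := @scheme1_odd_bounds eps r _ i f0 fr]; lra.
Qed.

(** An odd value is an average plus a correction, and a new increment is half an old one plus or
    minus a correction; [correction_dist] controls the corrections. *)
Lemma scheme_dist_step eps f g r U p :
  positive_seq (nabla f) -> positive_seq (nabla g) ->
  ratios_le r (nabla f) -> ratios_le r (nabla g) ->
  (forall i, `|f i - g i| <= U) -> (forall i, `|nabla f i - nabla g i| <= p) ->
  (forall i, `|scheme eps f i - scheme eps g i|
               <= U + correction_constant r * p) /\
  (forall i, `|nabla (scheme eps f) i - nabla (scheme eps g) i|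
               <= (2^-1 + correction_constant r) * p).
Proof.
move=> f0 g0 fr gr fgU fgp; set K := correction_constant r.
have r0 : 0 <= r by have [h _] := fr 0; exact: le_trans h.
have p0 : 0 <= p by apply: le_trans (fgp 0).
have Kp : 0 <= K * p by rewrite mulr_ge0 // correction_constant_ge0.
have cor i : `|correction (nabla f (i - 1)) (nabla f i) (nabla f (i + 1))
             - correction (nabla g (i - 1)) (nabla g i) (nabla g (i + 1))| <= K * p.
  have [f1 _] := fr (i - 1); have [g1 _] := gr (i - 1).
  have [_ f2] := fr i; have [_ g2] := gr i.
  by rewrite !subrK in f1 g1; apply: correction_dist.
split; apply: even_odd_ind => i.
- by rewrite !scheme_even; have := fgU i; lra.
- rewrite !scheme_odd //.
  by move: (fgU i) (fgU (i + 1)) (cor i); rewrite !ler_norml; lra.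
- rewrite /nabla !scheme_even !scheme_odd //.
  by move: (fgp i) (cor i); rewrite {1 2}/nabla !ler_norml; lra.
- rewrite /nabla (_ : 2 * i + 1 + 1 = 2 * (i + 1)); last by ring.
  rewrite !scheme_even !scheme_odd //.
  by move: (fgp i) (cor i); rewrite {1 2}/nabla !ler_norml; lra.
Qed.

(* The increments of f - g enter the norm because it is they that contract. *)
Definition dist_le W f g := exists U p, [/\ U + p <= W,
  forall i, `|f i - g i| <= U & forall i, `|nabla f i - nabla g i| <= p].

(** Valid for every [r] at the price of a growth factor, so suited only to a bounded number of
    levels. *)
Lemma dist_le_scheme eps f g r W :
  positive_seq (nabla f) -> positive_seq (nabla g) ->
  ratios_le r (nabla f) -> ratios_le r (nabla g) -> dist_le W f g ->
  dist_le ((1 + 2 * correction_constant r) * W) (scheme eps f) (scheme eps g).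
Proof.
move=> f0 g0 fr gr [U [p [UpW fgU fgp]]].
have [h1 h2] := scheme_dist_step eps f0 g0 fr gr fgU fgp.
set K := correction_constant r in h1 h2 *.
exists (U + K * p), ((2^-1 + K) * p); split=> //.
have r0 : 0 <= r by have [h _] := fr 0; exact: le_trans h.
have p0 : 0 <= p by apply: le_trans (fgp 0).
have U0 : 0 <= U by apply: le_trans (fgU 0).
have K0 : 0 <= K by exact: correction_constant_ge0.
have := mulr_ge0 K0 U0.
have : K * (U + p) <= K * W by rewrite ler_wpM2l.
lra.
Qed.

(** The new total is [U + (1/2 + 2 K) p] with [K] the correction constant, and [K < 1/4] at
    [r = 1/64]. *)
Lemma dist_le_scheme_small eps f g W :
  positive_seq (nabla f) -> positive_seq (nabla g) ->
  ratios_le 64^-1 (nabla f) -> ratios_le 64^-1 (nabla g) -> dist_le W f g ->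
  dist_le W (scheme eps f) (scheme eps g).
Proof.
move=> f0 g0 fr gr [U [p [UpW fgU fgp]]].
have [h1 h2] := scheme_dist_step eps f0 g0 fr gr fgU fgp.
exists (U + correction_constant 64^-1 * p), ((2^-1 + correction_constant 64^-1) * p).
split=> //; have p0 : 0 <= p by apply: le_trans (fgp 0).
rewrite /correction_constant; lra.
Qed.

Lemma dist_le_iter eps f g (m : nat) r W :
  positive_seq (nabla f) -> positive_seq (nabla g) -> 0 <= r ->
  (forall k h, h = f \/ h = g -> ratios_le r (nabla (iter k (scheme eps) h))) ->
  (forall k h, h = f \/ h = g -> (m <= k)%N ->
    ratios_le 64^-1 (nabla (iter k (scheme eps) h))) ->
  0 <= W -> dist_le W f g ->
  forall k, dist_le ((1 + 2 * correction_constant r) ^+ m * W)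
    (iter k (scheme eps) f) (iter k (scheme eps) g).
Proof.
move=> f0 g0 r0 hr hs W0 fgW k; set A := 1 + _.
have A1 : 1 <= A by rewrite /A lerDl mulr_ge0 // correction_constant_ge0.
have early j : dist_le (A ^+ j * W) (iter j (scheme eps) f) (iter j (scheme eps) g).
  elim: j => [|j IH]; first by rewrite mul1r.
  rewrite exprS -mulrA /=; apply: dist_le_scheme IH.
  - exact: (nabla_iter eps j f0).1.
  - exact: (nabla_iter eps j g0).1.
  - by apply: hr; left.
  - by apply: hr; right.
case: (leqP k m) => [km|/ltnW mk].
  have [U [p [UpW h1 h2]]] := early k; exists U, p; split=> //.
  by apply: (le_trans UpW); rewrite ler_wpM2r // ler_weXn2l.
(* Beyond level [m] the distance no longer grows, so the bound is uniform in [k]. *)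
rewrite -(subnK mk); elim: (k - m)%N => [|j IH]; first exact: early.
rewrite addSn /=; apply: dist_le_scheme_small IH.
- exact: (nabla_iter eps _ f0).1.
- exact: (nabla_iter eps _ g0).1.
- by apply: hs; [left|rewrite leq_addl].
- by apply: hs; [right|rewrite leq_addl].
Qed.

End Iterates.

(** * Existence of the limit function, its recovery from the iterates, and its behaviour under
    negation *)

Section LimitFunction.
Context {R : realType}.
Implicit Types (eps r x y B : R) (f g : int -> R) (F G : R -> R).

Lemma le_int_step (h : int -> R) : (forall i, h i <= h (i + 1)) ->
  forall i j, i <= j -> h i <= h j.
Proof.
move=> hS i j ij; rewrite -(subrK i j); have : 0 <= j - i by rewrite subr_ge0.
case: (j - i) => // n _; rewrite addrC; elim: n => [|n IH]; first by rewrite addr0.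
by apply: (le_trans IH); rewrite -addn1 PoszD addrA.
Qed.

(** Index of the left end of the level-[k] dyadic cell containing [x]. *)
Definition dyadic_floor (k : nat) x : int := Num.floor (x * 2 ^+ k).

Lemma dyadic_floorS k x :
  2 * dyadic_floor k x <= dyadic_floor k.+1 x <= 2 * dyadic_floor k x + 1.
Proof.
rewrite /dyadic_floor exprS (mulrCA x); set y := x * _.
have /andP[h1 h2] := floor_itv y; rewrite intrD in h2.
apply/andP; split; first by rewrite floor_ge_int intrM ler_pM2l.
rewrite -ltzD1 ltNge floor_ge_int -ltNge !intrD intrM; lra.
Qed.

Lemma dyadic_floorK k (i : int) : dyadic_floor k (i%:~R * 2 ^- k) = i.
Proof. by rewrite /dyadic_floor mulfVK ?intrKfloor // expf_neq0. Qed.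

Lemma dyadic_floor_near k x y : `|x - y| < 2 ^- k ->
  dyadic_floor k y <= dyadic_floor k x + 1.
Proof.
move=> xy; rewrite -ltzD1 /dyadic_floor ltNge floor_ge_int -ltNge.
have p0 : (0 : R) < 2 ^+ k by rewrite exprn_gt0.
have : `|x * 2 ^+ k - y * 2 ^+ k| < 1.
  by rewrite -mulrBl normrM (gtr0_norm p0) -ltr_pdivlMr // mul1r.
have /andP[h1 h2] := floor_itv (x * 2 ^+ k).
by move: h2; rewrite ltr_norml !intrD; lra.
Qed.

(* The values at level k + 1 lie between the neighbouring values at level k, so
   x |-> sup_k phi k (floor (2^k x)) is squeezed at every level. *)
Lemma interpolatory_limit (phi : nat -> int -> R) (e : nat -> R) :
  (forall k i, phi k.+1 (2 * i) = phi k i) ->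
  (forall k i, phi k i <= phi k (i + 1)) ->
  (forall k i, phi k (i + 1) - phi k i <= e k) -> e @ \oo --> 0 ->
  exists F, continuous F /\ forall k i, `|phi k i - F (i%:~R * 2 ^- k)| <= e k.
Proof.
move=> phi2 phiS phie e0.
have mono k := le_int_step (phiS k).
pose lo x k := phi k (dyadic_floor k x).
pose hi x k := phi k (dyadic_floor k x + 1).
have loS x k : lo x k <= lo x k.+1.
  by rewrite /lo -phi2; apply: mono; have /andP[] := dyadic_floorS k x.
have hiS x k : hi x k.+1 <= hi x k.
  rewrite /hi -[leRHS]phi2; apply: mono; have /andP[_ h] := dyadic_floorS k x.
  by rewrite mulrDr (_ : 2 * 1 = 1 + 1) // addrA lerD2r.
(* Both sides are compared at the common level [maxn k l]. *)
have lohi x k l : lo x k <= hi x l.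
  have lom : nondecreasing_seq (lo x) by apply/nondecreasing_seqP.
  have him : nonincreasing_seq (hi x) by apply/nonincreasing_seqP.
  apply: (le_trans (lom _ _ (leq_maxl k l))).
  apply: le_trans (him _ _ (leq_maxr k l)); exact: phiS.
pose F x := sup (range (lo x)).
have loF x k : lo x k <= F x.
  apply: ub_le_sup; last by exists k.
  by exists (hi x 0%N) => _ [l _ <-].
have Fhi x k : F x <= hi x k.
  by apply: ge_sup => [|_ [l _ <-] //]; exists (lo x 0%N); exists 0%N.
exists F; split=> [x|k i]; last first.
  have := loF (i%:~R * 2 ^- k) k; have := Fhi (i%:~R * 2 ^- k) k.
  rewrite /lo /hi dyadic_floorK; have := phie k i.
  by rewrite ler_norml; lra.
(* At level [k], [F v] is bounded above two cells to the right of where [F u] is bounded below,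
   hence [2 * e k]. *)
have close k u v : `|u - v| < 2 ^- k -> F v - F u <= 2 * e k.
  move=> uv; have := Fhi v k; have := loF u k.
  have := mono k _ _ (lerD (dyadic_floor_near uv) (lexx 1)).
  have := phie k (dyadic_floor k u); have := phie k (dyadic_floor k u + 1).
  by rewrite /lo /hi; lra.
apply/cvgrPdist_lt => a a0.
have /cvgrPdist_lt/(_ (a / 2)) := e0; case; first by rewrite divr_gt0.
move=> k _ /(_ k (leqnn k)) /=; rewrite sub0r normrN => ek.
have ek' : 2 * e k < a by have := ler_norm (e k); lra.
have p0 : (0 : R) < 2 ^- k by rewrite invr_gt0 exprn_gt0.
near=> y.
have xy : `|x - y| < 2 ^- k by near: y; exact: cvgr_dist_lt.
have yx : `|y - x| < 2 ^- k by rewrite distrC.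
by have := close _ _ _ xy; have := close _ _ _ yx; rewrite ltr_norml; lra.
Unshelve. all: by end_near. Qed.

Lemma le_sup_norm {I : Type} (h : I -> R) i : (`|h i|%:E <= sup_norm h)%E.
Proof. by apply: ereal_sup_ubound; exists i. Qed.

Lemma sup_norm_le {I : Type} (h : I -> R) B :
  (forall i, `|h i| <= B) -> (sup_norm h <= B%:E)%E.
Proof. by move=> hB; apply: ge_ereal_sup => _ [i _ <-]; rewrite lee_fin. Qed.

(** A uniform bound on the ratios gives one decay factor [theta < 1] for the increments at all
    levels, and [interpolatory_limit] applies with this geometric error. *)
Lemma limit_function_exists eps f r : bounded_fun f ->
  positive_seq (nabla f) -> 0 <= r ->
  (forall k, ratios_le r (nabla (iter k (scheme eps) f))) ->
  exists F, is_limit_function eps f F.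
Proof.
move=> /bounded_funE[M fM] f0 r0 fr.
pose theta := 1 - (2 * (2 + r))^-1.
have theta01 : 0 <= theta < 1.
  have : 0 < (2 * (2 + r))^-1 by rewrite invr_gt0; lra.
  have : (2 * (2 + r))^-1 <= 1 by rewrite invf_le1; lra.
  by rewrite /theta; lra.
have e0 : geometric (2 * M) theta @ \oo --> 0.
  by apply: cvg_geometric; rewrite ger0_norm; lra.
have pos k := (nabla_iter eps k f0).1.
have nabla_le g : positive_seq (nabla g) -> forall i, g i <= g (i + 1).
  by move=> g0 i; rewrite -subr_ge0 ltW // g0.
have decay k i : nabla (iter k (scheme eps) f) i <= geometric (2 * M) theta k.
  rewrite /geometric /= mulrC.
  elim: k i => [|k IH] i /=.
    rewrite mul1r /nabla; move: (fM i) (fM (i + 1)); rewrite !ler_norml; lra.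
  by rewrite exprS -mulrA; apply: nabla_scheme_le.
have [F [Fc FE]] := @interpolatory_limit (fun k => iter k (scheme eps) f) _
  (fun k i => scheme_even eps _ i)
  (fun k => nabla_le _ (pos k)) decay e0.
exists F; split=> //; apply: (@squeeze_cvge _ _ _ _ (cst 0%E) _
  (fun k => (geometric (2 * M) theta k)%:E)); first last.
- by apply/fine_cvgP; split; [apply: nearW|exact: e0].
- exact: cvg_cst.
apply: nearW => k; apply/andP; split; last exact: sup_norm_le.
by apply: le_trans (le_sup_norm _ 0); rewrite lee_fin.
Qed.

Lemma dyadic_floor_cvg x : (dyadic_floor k x)%:~R * 2 ^- k @[k --> \oo] --> x.
Proof.
apply/cvgrPdist_lt => a a0.
have /cvgrPdist_lt/(_ a a0) : (2^-1 : R) ^+ k @[k --> \oo] --> 0.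
  by apply: cvg_expr; rewrite ger0_norm ?invf_lt1 // ltr1n.
apply: filterS => k; rewrite sub0r normrN exprVn; apply: le_lt_trans.
have p0 : (0 : R) < 2 ^+ k by rewrite exprn_gt0.
rewrite [leRHS]gtr0_norm ?invr_gt0 // -{1}(mulfK (lt0r_neq0 p0) x) -mulrBl.
rewrite normrM (gtr0_norm (_ : 0 < 2 ^- k)) ?invr_gt0 //.
rewrite ler_piMl ?invr_ge0 ?ltW // /dyadic_floor.
by have /andP[] := floor_itv (x * 2 ^+ k); rewrite intrD ltr_norml; lra.
Qed.

(** At the dyadic floor of [x], the iterate is [F], which converges by continuity, plus an error
    dominated by the vanishing sup norm. *)
Lemma limit_function_cvg eps f F : is_limit_function eps f F ->
  forall x, iter k (scheme eps) f (dyadic_floor k x) @[k --> \oo] --> F x.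
Proof.
move=> [Fc Fl] x.
have FF : F ((dyadic_floor k x)%:~R * 2 ^- k) @[k --> \oo] --> F x.
  by apply: continuous_cvg; [exact: Fc|exact: dyadic_floor_cvg].
rewrite (_ : (fun k => _) = (fun k => F ((dyadic_floor k x)%:~R * 2 ^- k) +
   (iter k (scheme eps) f (dyadic_floor k x)
     - F ((dyadic_floor k x)%:~R * 2 ^- k)))); last first.
  by apply/funext => k; rewrite subrKC.
rewrite -[X in _ --> X]addr0; apply: cvgD => //.
apply/cvgrPdist_lt => a a0.
(* The extended-real norm is finite from some level on; real estimates start there. *)
have /fine_cvgP[ffin /cvgrPdist_lt/(_ a a0)] := Fl.
apply: filterS2 ffin => k; rewrite !sub0r !normrN => ffin; apply: le_lt_trans.
have := le_sup_norm (fun i : int => iter k (scheme eps) f i - F (i%:~R * 2 ^- k))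
  (dyadic_floor k x).
by rewrite -[leRHS]fineK // lee_fin => /le_trans; apply; exact: ler_norm.
Qed.


Lemma limit_function_dist eps f g F G B :
  is_limit_function eps f F -> is_limit_function eps g G ->
  (forall k i, `|iter k (scheme eps) f i - iter k (scheme eps) g i| <= B) ->
  forall x, `|F x - G x| <= B.
Proof.
move=> fF gG fgB x.
have := cvg_norm (cvgB (@limit_function_cvg eps f F fF x)
  (@limit_function_cvg eps g G gG x)).
by move=> /(_ _ _)/cvgr_to_le; apply; apply: nearW => k; exact: fgB.
Qed.

(** The quotient under the root is unchanged by negation and the rest is linear. This reduces
    decreasing sequences to increasing ones. *)
Lemma schemeN eps f : scheme eps (\- f) = \- (scheme eps f).
Proof.
apply/funext; apply: even_odd_ind => i; first by rewrite /= !scheme_even.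
rewrite /scheme /= !weave_odd /=.
have -> : (- f (i + 2) - - f (i - 1)) / (- f (i + 1) - - f i) =
    (f (i + 2) - f (i - 1)) / (f (i + 1) - f i).
  by rewrite -!opprD invrN mulrNN.
ring.
Qed.

Lemma is_limit_functionN eps f F :
  is_limit_function eps f F -> is_limit_function eps (\- f) (\- F).
Proof.
move=> [Fc Fl]; split; first by move=> x; apply: cvgN; exact: Fc.
rewrite (_ : (fun k => _) = (fun k =>
  sup_norm (fun i : int => iter k (scheme eps) f i - F (i%:~R * 2 ^- k)))) //.
apply/funext => k; congr ereal_sup; apply: eq_imagel => i _.
have -> : iter k (scheme eps) (\- f) = \- (iter k (scheme eps) f).
  by elim: k => //= k ->; rewrite schemeN.
by rewrite /= -opprD normrN.
Qed.

End LimitFunction.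

(** * Stability for increasing sequences *)

Section Stability.
Context {R : realType}.
Implicit Types (eps eta delta B : R) (f g : int -> R) (F G : R -> R).

Lemma rho_nablaN f : rho (nabla (\- f)) = rho (nabla f).
Proof.
rewrite -[RHS](@rho_scale _ (-1)) ?oppr_eq0 ?oner_eq0 //; congr rho.
by apply/funext => i; rewrite /nabla /= mulN1r opprD.
Qed.

(** Stated for arbitrary limit functions, so that it also applies to negatives of the chosen
    ones. *)
Lemma stable_increasing eps eta delta delta_eta :
  0 < delta -> delta < delta_eta -> 0 <= eta < 1 ->
  rho_contractive eps eta delta_eta ->
  exists C, 0 < C /\ forall f g, bounded_fun f -> bounded_fun g ->
    positive_seq (nabla f) -> positive_seq (nabla g) ->
    (rho (nabla f) < delta%:E)%E -> (rho (nabla g) < delta%:E)%E ->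
    (exists F, is_limit_function eps f F) /\
    forall F G B, is_limit_function eps f F -> is_limit_function eps g G ->
      (forall i, `|f i - g i| <= B) -> forall x, `|F x - G x| <= C * B.
Proof.
move=> d0 dlt /andP[eta0 eta1] contr.
pose r := 2 * (2 + delta) * (1 + delta).
have r0 : 0 <= r by rewrite /r; nra.
have ratios h k : bounded_fun h -> positive_seq (nabla h) ->
    (rho (nabla h) < delta%:E)%E ->
    ratios_le (eta ^+ k./2 * r) (nabla (iter k (scheme eps) h)).
  move=> bh h0 hd; apply/rho_leP; rewrite rho_nabla_iter //.
  apply: (rho_decay (ltW d0) eta0 contr) (ltW hd) k => //.
    exact: bounded_nabla.
  by apply: (lt_trans hd); rewrite lte_fin.
have ratios_r h k : bounded_fun h -> positive_seq (nabla h) ->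
    (rho (nabla h) < delta%:E)%E -> ratios_le r (nabla (iter k (scheme eps) h)).
  move=> bh h0 hd; apply: ratios_le_trans (ratios h k bh h0 hd).
  by rewrite ler_piMl // exprn_ile1 // ltW.
(* [m] depends only on [delta] and [eta], which makes the final constant uniform in [f] and [g]. *)
have [m small] : exists m, forall k, (m <= k)%N -> eta ^+ k./2 * r <= 64^-1.
  have : geometric r eta @ \oo --> 0 by apply: cvg_geometric; rewrite ger0_norm.
  move/cvgrPdist_lt => /(_ 64^-1); case; first by rewrite invr_gt0.
  (* Doubled, because the decay gains one factor [eta] per two levels. *)
  move=> n _ hn; exists n.*2 => k nk.
  have /= := hn k./2; rewrite geq_half_double => /(_ nk).
  by rewrite sub0r normrN mulrC => /ltW; apply: le_trans; exact: ler_norm.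
pose A := 1 + 2 * correction_constant r.
have A0 : 0 < A by rewrite ltr_pwDl // mulr_ge0 // correction_constant_ge0.
exists (A ^+ m * 3); split; first by rewrite mulr_gt0 // exprn_gt0.
move=> f g bf bg f0 g0 fd gd; split.
  by apply: (limit_function_exists bf f0 r0) => k; exact: ratios_r.
move=> F G B fF gG fgB; apply: (limit_function_dist fF gG) => k i.
have B0 : 0 <= B by apply: le_trans (fgB 0).
(* Increments of [f - g] are at most [2 B], whence the factor 3 in the constant. *)
have start : dist_le (3 * B) f g.
  exists B, (2 * B); split=> // [|j]; first by lra.
  by move: (fgB j) (fgB (j + 1)); rewrite /nabla !ler_norml; lra.
have [|||U [p [Up h hp]]] := @dist_le_iter _ eps f g m r _ f0 g0 r0 _ _ _ start k.
- by move=> j h [] ->; exact: ratios_r.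
- move=> j h fg mj; apply: (ratios_le_trans (small j mj)).
  by case: fg => ->; exact: ratios.
- by rewrite mulr_ge0.
have p0 : 0 <= p by apply: le_trans (hp 0).
by rewrite -mulrA; apply: (le_trans (h i)); apply: le_trans Up; rewrite lerDl.
Qed.

End Stability.

(** * Stability for both directions of monotonicity *)

Theorem mainTheorem7 (R : realType) (eps : R) (heps : 0 <= eps <= Num.sqrt 2)
    (delta_ : R -> R) (hdelta_ : admissible_thresholds eps delta_)
    (delta : R) (hdelta0 : 0 < delta) (hdelta : (delta%:E < delta_bar delta_)%E) :
  exists C : R, 0 < C /\
    forall f0 g0 : int -> R,
      bounded_fun f0 -> bounded_fun g0 ->
      (strictly_increasing f0 /\ strictly_increasing g0) \/
        (strictly_decreasing f0 /\ strictly_decreasing g0) ->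
      (rho (nabla f0) < delta%:E)%E -> (rho (nabla g0) < delta%:E)%E ->
      (sup_norm (limit_function eps f0 \- limit_function eps g0)%R
         <= C%:E * sup_norm (f0 \- g0)%R)%E.
Proof.
(* As [delta] lies below a supremum, some single [eta] already has its threshold above [delta]. *)
have [_ [eta eta_itv <-]] := ereal_sup_gt hdelta; rewrite lte_fin => delta_lt.
have [_ contr] := hdelta_ eta eta_itv.
have eta01 : 0 <= eta < 1 by move: eta_itv => /=; lra.
have [C [C0 stable]] := stable_increasing hdelta0 delta_lt eta01 contr.
exists C; split=> // f g bf bg mono fd gd.
(* Existence excludes the default value in [limit_function]. *)
have limitP h : (exists F, is_limit_function eps h F) ->
  is_limit_function eps h (limit_function eps h) by exact: xgetPex.
(* The sup norm of [f - g] is finite by boundedness, so its real value can serve as [B]. *)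
suff dist B : (forall i, `|f i - g i| <= B) ->
    forall x, `|limit_function eps f x - limit_function eps g x| <= C * B.
  have [M1 fM] := (bounded_funE f).1 bf; have [M2 gM] := (bounded_funE g).1 bg.
  have le_fg : (sup_norm (f \- g)%R <= (M1 + M2)%:E)%E.
    by apply: sup_norm_le => i; apply: (le_trans (ler_normB _ _)); exact: lerD.
  have fin : sup_norm (f \- g) \is a fin_num.
    rewrite fin_numElt (le_lt_trans le_fg) ?ltry // andbT.
    exact: lt_le_trans (ltNyr _) (le_sup_norm _ 0).
  rewrite -(fineK fin) -EFinM; apply: sup_norm_le; apply: dist => i.
  by rewrite -lee_fin fineK //; exact: (le_sup_norm (f \- g)).
case: mono => [[fi gi]|[fi gi]].
  have f0 := increasing_nabla fi; have g0 := increasing_nabla gi.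
  have [/limitP fF H1] := stable f g bf bg f0 g0 fd gd.
  (* The roles are exchanged only to obtain a limit function for [g]. *)
  have [/limitP gG _] := stable g f bg bf g0 f0 gd fd.
  by move=> fgB x; exact: H1 fF gG fgB x.
have bN (h : int -> R) : bounded_fun h -> bounded_fun (\- h).
  by move=> /bounded_funE[M hM]; apply/bounded_funE; exists M => i; rewrite /= normrN.
have incN (h : int -> R) : strictly_decreasing h -> positive_seq (nabla (\- h)).
  by move=> hd; apply: increasing_nabla => i j ij; rewrite /= ltrN2; exact: hd.
(* The choice is made for [h], not for [\- h]: existence is carried back to [h] by a second
   negation. *)
have limitN h : (exists F, is_limit_function eps (\- h) F) ->
    is_limit_function eps (\- h) (\- limit_function eps h).
  move=> [F hF]; apply: is_limit_functionN; apply: limitP; exists (\- F).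
  by rewrite -[h](_ : \- (\- h) = h);
    [exact: is_limit_functionN|apply/funext => i; exact: opprK].
have dN (h : int -> R) : (rho (nabla h) < delta%:E)%E ->
    (rho (nabla (\- h)%R) < delta%:E)%E.
  by rewrite rho_nablaN.
have [/limitN fF H1] := stable _ _ (bN _ bf) (bN _ bg)
  (incN _ fi) (incN _ gi) (dN _ fd) (dN _ gd).
have [/limitN gG _] := stable _ _ (bN _ bg) (bN _ bf)
  (incN _ gi) (incN _ fi) (dN _ gd) (dN _ fd).
move=> fgB x.
have : forall i, `|(\- f) i - (\- g) i| <= B.
  by move=> i; rewrite /= -opprD normrN.
by move=> /(H1 _ _ _ fF gG) /(_ x); rewrite /= -opprD normrN.
Qed.
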